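(* (i) There exists a 5-point set $K \subseteq \mathbb{R}^{2\times 2}_{\mathrm{tri}}$ such that $L(K)$ is not compact. (ii) There exists a 5-point set $K \subseteq \mathbb{R}^{2 \times 2}_{\mathrm{sym}}$ such that $L(K)$ is not compact.
   Context: $\mathbb{R}^{2\times 2}$ is the space of real $2\times 2$ matrices, $\mathbb{R}^{2\times 2}_{\mathrm{tri}}$ is its subspace of upper triangular matrices, and $\mathbb{R}^{2\times 2}_{\mathrm{sym}}$ is its subspace of symmetric matrices. Two matrices $X,Y$ are rank-one connected if $\operatorname{rank}(X-Y)=1$. A set $\mathcal{S} \subseteq \mathbb{R}^{2\times 2}$ is lamination convex if $\lambda X + (1-\lambda) Y \in \mathcal{S}$ for all $\lambda \in [0,1]$ whenever $X,Y \in \mathcal{S}$ are rank-one connected. For $K \subseteq \mathbb{R}^{2 \times 2}$, $L(K)$ is the smallest lamination convex set containing $K$. *)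

(* Defs.v *)
From HB Require Import structures.
From mathcomp Require Import all_boot all_order all_algebra.
From mathcomp Require Import all_classical all_reals all_analysis.

Set Implicit Arguments.
Unset Strict Implicit.
Unset Printing Implicit Defensive.

Import Order.TTheory GRing.Theory Num.Theory.
Import numFieldNormedType.Exports.

Local Open Scope classical_set_scope.
Local Open Scope ring_scope.

Definition rank_one_connected (R : realType) (X Y : 'M[R]_2) : Prop :=
  \rank (X - Y) = 1%N.

Definition lamination_convex (R : realType) (S : set 'M[R]_2) : Prop :=
  forall X Y : 'M[R]_2, S X -> S Y -> rank_one_connected X Y ->
  forall t : R, 0 <= t <= 1 -> S (t *: X + (1 - t) *: Y).

Definition lamination_hull (R : realType) (K : set 'M[R]_2) : set 'M[R]_2 :=
  smallest (@lamination_convex R) K.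

(* MathComp's [is_trig_mx] is lower triangularity, hence the transpose. *)
Definition upper_triangular (R : realType) : set 'M[R]_2 :=
  [set A | is_trig_mx A^T].

Definition symmetric_matrices (R : realType) : set 'M[R]_2 :=
  [set A | A^T = A].

(* Main.v *)
(* Let P1, ..., P4 be the diagonal matrices diag(-1,-3), diag(3,-1), diag(1,3),
   diag(-3,1), no two of which are rank-one connected (a "T4" configuration).
   The set {X | X_01 > 0} together with P1, ..., P4 is lamination convex, so
   it contains the hull of {P1, ..., P4, Q} as soon as Q_01 > 0.  If Q is well
   chosen, moving from Q successively towards P2, P3, P4, P1, each time along a
   rank-one segment and up to the point which is rank-one connected to the next
   P_i, produces a sequence of points of the hull spiralling towards
   diag(-1,-1), which is outside the hull.  In the triangular case Q projects
   to diag(-1,-1); in the symmetric case Q lies on the conic of matrices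
   rank-one connected to both P1 and P2. *)
Require Import Defs.
From HB Require Import structures.
From mathcomp Require Import all_boot all_order all_algebra.
From mathcomp Require Import all_classical all_reals all_analysis.
From mathcomp Require Import ring lra.

Import Order.TTheory GRing.Theory Num.Theory.
Import numFieldNormedType.Exports.

Local Open Scope classical_set_scope.
Local Open Scope ring_scope.

(** * Two-by-two matrices and rank-one segments *)

Definition mx2 {R : realType} (a b c d : R) : 'M[R]_2 :=
  \matrix_(i, j) if i == 0 then if j == 0 then a else b
                 else if j == 0 then c else d.

Lemma mx2_eqP (R : realType) (A B : 'M[R]_2) :
  A 0 0 = B 0 0 -> A 0 1 = B 0 1 -> A 1 0 = B 1 0 -> A 1 1 = B 1 1 -> A = B.
Proof.
move=> e00 e01 e10 e11; apply/matrixP => i j.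
have ord2 (k : 'I_2) : k = 0 \/ k = 1.
  by case: k => -[|[|//]] lek; [left|right]; apply/val_inj.
by case: (ord2 i) => ->; case: (ord2 j) => ->.
Qed.

Lemma det_mx2 (R : realType) (A : 'M[R]_2) :
  \det A = A 0 0 * A 1 1 - A 0 1 * A 1 0.
Proof.
rewrite (expand_det_row _ 0) !big_ord_recl big_ord0 /cofactor !det_mx11 !mxE /=.
have -> : lift 0 (0 : 'I_1) = 1 :> 'I_2 by apply/val_inj.
have -> : lift 1 (0 : 'I_1) = 0 :> 'I_2 by apply/val_inj.
by rewrite /= !addr0 expr0 expr1; ring.
Qed.

Lemma rank_one_connected_det (R : realType) (X Y : 'M[R]_2) :
  rank_one_connected X Y -> \det (X - Y) = 0.
Proof.
move=> rXY; apply/eqP; apply: contraT => dXY.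
suff : \rank (X - Y) = 2 by rewrite rXY.
by apply: mxrank_unit; rewrite unitmxE unitfE.
Qed.

Lemma det_rank_one_connected (R : realType) (X Y : 'M[R]_2) :
  X <> Y -> \det (X - Y) = 0 -> rank_one_connected X Y.
Proof.
move=> nXY dXY; apply/eqP; rewrite eqn_leq lt0n mxrank_eq0 subr_eq0.
rewrite (introN eqP nXY) andbT -ltnS ltn_neqAle rank_leq_row andbT.
apply/eqP => rXY; have : X - Y \in unitmx by rewrite -row_free_unit /row_free rXY.
by rewrite unitmxE unitfE dXY eqxx.
Qed.

Lemma hull_sub (R : realType) (K : set 'M[R]_2) : K `<=` lamination_hull K.
Proof. exact: sub_gen_smallest. Qed.

(** The vanishing determinant also admits X = Y, where the segment is a single point; each move
    inside the hull thus rests on one polynomial identity. *)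
Lemma hull_segment (R : realType) (K : set 'M[R]_2) (X Y : 'M[R]_2) (t : R) :
  lamination_hull K X -> lamination_hull K Y -> \det (X - Y) = 0 ->
  0 <= t <= 1 -> lamination_hull K (t *: X + (1 - t) *: Y).
Proof.
move=> hX hY dXY t01; case: (eqVneq X Y) => [<-|/eqP nXY].
  by rewrite -scalerDl addrC subrK scale1r.
move=> S [lS KS]; apply: (lS X Y) t01; [exact: hX|exact: hY|exact: det_rank_one_connected].
Qed.

(** The entries of the new point are given by equations, so that moves to explicit points reduce to
    goals for [lra] or [field]. *)
Lemma hull_mx2 (R : realType) (K : set 'M[R]_2) (t a b c d a' b' c' d' x y z w : R) :
  lamination_hull K (mx2 a b c d) -> lamination_hull K (mx2 a' b' c' d') ->
  (a - a') * (d - d') = (b - b') * (c - c') -> 0 <= t <= 1 ->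
  x = t * a + (1 - t) * a' -> y = t * b + (1 - t) * b' ->
  z = t * c + (1 - t) * c' -> w = t * d + (1 - t) * d' ->
  lamination_hull K (mx2 x y z w).
Proof.
move=> hX hY dXY t01 -> -> -> ->.
have -> : mx2 (t * a + (1 - t) * a') (t * b + (1 - t) * b')
              (t * c + (1 - t) * c') (t * d + (1 - t) * d') =
          t *: mx2 a b c d + (1 - t) *: mx2 a' b' c' d'.
  by apply: mx2_eqP; rewrite !mxE.
by apply: hull_segment => //; rewrite det_mx2 !mxE /= dXY subrr.
Qed.

(** * The T4 configuration and its barrier *)

Definition T4 (R : realType) : seq 'M[R]_2 :=
  [:: mx2 (-1) 0 0 (-3); mx2 3 0 0 (-1); mx2 1 0 0 3; mx2 (-3) 0 0 1].

Lemma T4P (R : realType) (P : 'M[R]_2 -> Prop) :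
  P (mx2 (-1) 0 0 (-3)) -> P (mx2 3 0 0 (-1)) -> P (mx2 1 0 0 3) ->
  P (mx2 (-3) 0 0 1) -> forall X, X \in T4 R -> P X.
Proof. by move=> P1 P2 P3 P4 X; rewrite !inE => /or4P[] /eqP ->. Qed.

Lemma T4_det (R : realType) (X Y : 'M[R]_2) :
  X \in T4 R -> Y \in T4 R -> \det (X - Y) = 0 -> X = Y.
Proof.
by rewrite !inE => /or4P[] /eqP -> /or4P[] /eqP -> //;
  rewrite det_mx2 !mxE /= => ?; exfalso; lra.
Qed.

Definition barrier (R : realType) : set 'M[R]_2 :=
  [set X : 'M[R]_2 | 0 < X 0 1 \/ X \in T4 R].

(** All of [T4] has upper right entry 0, so for 0 < t < 1 a single endpoint with positive entry
    makes the combination positive. Two endpoints in [T4] coincide by [T4_det]. *)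
Lemma barrier_lamination_convex (R : realType) : lamination_convex (barrier R).
Proof.
move=> X Y bX bY rXY t /andP[t0 t1].
have [->|tn0] := eqVneq t 0; first by rewrite scale0r add0r subr0 scale1r.
have [->|tn1] := eqVneq t 1; first by rewrite subrr scale0r addr0 scale1r.
have {t0 tn0} t0 : 0 < t by rewrite lt_neqAle eq_sym tn0.
have {t1 tn1} t1 : 0 < 1 - t by rewrite subr_gt0 lt_neqAle tn1.
have T4_01 Z : Z \in T4 R -> Z 0 1 = 0 by move: Z; apply: T4P; rewrite mxE.
case: bX bY => [X0|TX] [Y0|TY].
- by left; rewrite !mxE addr_gt0 ?mulr_gt0.
- by left; rewrite !mxE (T4_01 _ TY) mulr0 addr0 mulr_gt0.
- by left; rewrite !mxE (T4_01 _ TX) mulr0 add0r mulr_gt0.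
- right; rewrite -(T4_det _ _ _ TX TY (rank_one_connected_det _ _ _ rXY)).
  by rewrite -scalerDl addrC subrK scale1r.
Qed.

(** * Five-point sets and a criterion for non-compactness *)

Definition five_points {R : realType} (Q : 'M[R]_2) : set 'M[R]_2 :=
  [set` Q :: T4 R].

Lemma five_points_card (R : realType) (Q : 'M[R]_2) :
  0 < Q 0 1 -> (five_points Q #= `I_5)%card.
Proof.
move=> Q0; have Q_T4 : Q \notin T4 R.
  by apply: contraTN Q0; move: Q; apply: T4P; rewrite mxE ltxx.
have T4_uniq : uniq (T4 R).
  (* The upper left entries -1, 3, 1, -3 already tell the four points apart. *)
  apply: (@map_uniq _ _ (fun X : 'M[R]_2 => X 0 0)).
  by rewrite /= !inE !mxE /= !negb_or; apply/and4P; split=> //; lra.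
have s_uniq : uniq (Q :: T4 R) by rewrite cons_uniq Q_T4.
have -> : five_points Q = nth 0 (Q :: T4 R) @` `I_5.
  apply/seteqP; split=> X /=; first by move=> /(nthP 0)[i i5 <-]; exists i.
  by move=> [i i5 <-]; exact: mem_nth.
by apply: inj_card_eq => i j /set_mem i5 /set_mem j5; apply/uniqP.
Qed.

Lemma five_points_sub_barrier (R : realType) (Q : 'M[R]_2) :
  0 < Q 0 1 -> lamination_hull (five_points Q) `<=` barrier R.
Proof.
move=> Q0; apply: smallest_sub; first exact: barrier_lamination_convex.
by move=> X; rewrite /five_points/= inE => /orP[/eqP ->|TX]; [left|right].
Qed.

(** Measures how far X is from having diagonal (-1,-1) and upper right entry 0; that entry is
    nonnegative on [barrier], hence carries no absolute value. *)
Definition gap {R : realType} (X : 'M[R]_2) : R :=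
  X 0 1 + `|X 0 0 + 1| + `|X 1 1 + 1|.

Lemma gap_gt0 (R : realType) (X : 'M[R]_2) : barrier R X -> 0 < gap X.
Proof.
case=> [X0|]; first by rewrite /gap -addrA ltr_pwDl// addr_ge0.
move: X; apply: T4P; rewrite /gap !mxE /=.
(* diag(-1,-3) is detected by its lower right entry, the other three points by their upper left
   entry. *)
- by rewrite add0r; apply: ltr_wpDl; rewrite // normr_gt0; apply/eqP; lra.
- by rewrite add0r; apply: ltr_pwDl; rewrite // normr_gt0; apply/eqP; lra.
- by rewrite add0r; apply: ltr_pwDl; rewrite // normr_gt0; apply/eqP; lra.
- by rewrite add0r; apply: ltr_pwDl; rewrite // normr_gt0; apply/eqP; lra.
Qed.

Lemma gap_continuous (R : realType) : continuous (@gap R).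
Proof.
have cont_entry i j : continuous (fun X : 'M[R]_2 => X i j).
  exact: coord_continuous.
have cont_norm i j : continuous (fun X : 'M[R]_2 => `|X i j + 1|).
  move=> X; apply: (@cvg_norm _ _ _ (nbhs X)).
  by apply: cvgD; [exact: cont_entry|exact: cvg_cst].
move=> X; exact: (cvgD (cvgD (cont_entry 0 1 X) (cont_norm 0 0 X)) (cont_norm 1 1 X)).
Qed.

(* On a compact hull, [gap] would attain a positive minimum, but it tends to 0
   along the spiral. *)
Lemma hull_not_compact (R : realType) (Q : 'M[R]_2) (spiral : R -> 'M[R]_2) (e0 : R) :
  0 < Q 0 1 -> 0 < e0 -> spiral e0 = Q ->
  (forall e, 0 < e <= e0 -> lamination_hull (five_points Q) (spiral e) ->
     lamination_hull (five_points Q) (spiral (e / 16))) ->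
  (forall e, 0 < e <= e0 -> gap (spiral e) <= 16 * e) ->
  ~ compact (lamination_hull (five_points Q)).
Proof.
move=> Q0 e0_gt0 spiralQ step gap_le cH.
set H := lamination_hull _ in step cH.
have spiralH n : H (spiral (e0 / 16 ^+ n)) /\ 0 < e0 / 16 ^+ n <= e0.
  elim: n => [|n [IH /andP[e_gt0 e_le]]].
    rewrite expr0 divr1 spiralQ e0_gt0 lexx; split=> //; apply: hull_sub.
    by rewrite /five_points/= inE eqxx.
  have -> : e0 / 16 ^+ n.+1 = e0 / 16 ^+ n / 16 by rewrite exprSr invfM mulrA.
  split; first by apply: step IH; rewrite e_gt0.
  by lra.
have [|A /set_mem HA gap_min] := compact_EVT_min _ cH
  (continuous_subspaceT (@gap_continuous R)).
  by exists (spiral (e0 / 16 ^+ 0)); have [] := spiralH 0.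
have gA := gap_gt0 _ _ (five_points_sub_barrier _ _ Q0 _ HA).
(* Since 16 e0 / gap A < n < 16^n, the n-th point of the spiral has smaller gap than the minimiser
   A. *)
pose n := Num.bound (16 * e0 / gap A).
have [Hn en] := spiralH n.
have : gap A <= 16 * (e0 / 16 ^+ n).
  by apply: le_trans (gap_le _ en); apply: gap_min; exact: mem_set.
apply/negP; rewrite -ltNge.
have : 16 * e0 / gap A < 16 ^+ n.
  apply: (lt_trans (archi_boundP _)); first by rewrite divr_ge0 ?mulr_ge0 ?ltW.
  by rewrite -natrX ltr_nat ltn_expl.
by rewrite ltr_pdivrMr// [16 * (_ / _)]mulrA ltr_pdivrMr ?exprn_gt0//
  [gap A * _]mulrC.
Qed.

Lemma five_points_T4 (R : realType) (Q X : 'M[R]_2) :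
  X \in T4 R -> lamination_hull (five_points Q) X.
Proof. by move=> TX; apply: hull_sub; rewrite /five_points/= inE TX orbT. Qed.

(** * The triangular spiral *)

Definition tri_spiral (R : realType) (e : R) : 'M[R]_2 := mx2 (-1) e 0 (-1).

(** Each move goes to the midpoint with the next point of [T4], which shares a diagonal entry, so
    the triangular difference is singular. The diagonal runs through the corners of the square with
    entries 1 and -1, and the upper right entry is halved four times. *)
Lemma tri_spiral_step (R : realType) (Q : 'M[R]_2) (e : R) :
  lamination_hull (five_points Q) (tri_spiral R e) ->
  lamination_hull (five_points Q) (tri_spiral R (e / 16)).
Proof.
move=> h0.
have inT X : X \in T4 R -> _ := five_points_T4 R Q X.
have h1 : lamination_hull (five_points Q) (mx2 1 (e / 2) 0 (-1)).
  by apply: (hull_mx2 _ _ 2^-1 _ _ _ _ 3 0 0 (-1) _ _ _ _ h0);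
    [apply: inT; rewrite !inE eqxx ?orbT|lra..].
have h2 : lamination_hull (five_points Q) (mx2 1 (e / 4) 0 1).
  by apply: (hull_mx2 _ _ 2^-1 _ _ _ _ 1 0 0 3 _ _ _ _ h1);
    [apply: inT; rewrite !inE eqxx ?orbT|lra..].
have h3 : lamination_hull (five_points Q) (mx2 (-1) (e / 8) 0 1).
  by apply: (hull_mx2 _ _ 2^-1 _ _ _ _ (-3) 0 0 1 _ _ _ _ h2);
    [apply: inT; rewrite !inE eqxx ?orbT|lra..].
by apply: (hull_mx2 _ _ 2^-1 _ _ _ _ (-1) 0 0 (-3) _ _ _ _ h3);
    [apply: inT; rewrite !inE eqxx ?orbT|lra..].
Qed.

(** * The symmetric spiral *)

(* A rational parametrization of the conic of symmetric matrices which are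
   rank-one connected to both s diag(-1,-3) and s diag(3,-1), for s = 1, -1. *)
Definition sym_spiral (R : realType) (s e : R) : 'M[R]_2 :=
  let u := 4 * e ^+ 2 / (1 + 2 * e ^+ 2) in
  let b := 4 * e / (1 + 2 * e ^+ 2) in
  mx2 (s * (-1 + 2 * u)) b b (s * (-1 - u)).

(* The central symmetry X |-> -X of T4 only flips s, so two such half turns make
   a full turn. *)
Lemma sym_spiral_half (R : realType) (K : set 'M[R]_2) (s e : R) :
  (s = 1 \/ s = -1) -> 0 < e <= 2^-1 ->
  lamination_hull K (mx2 (s * 3) 0 0 (- s)) ->
  lamination_hull K (mx2 s 0 0 (s * 3)) ->
  lamination_hull K (sym_spiral R s e) ->
  lamination_hull K (sym_spiral R (- s) (e / 4)).
Proof.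
move=> s1 /andP[e0 e2] hP hP' h0.
have e_sq : e ^+ 2 <= 4^-1 by nra.
have e_sq0 : 0 <= e ^+ 2 by apply: sqr_ge0.
have d0 : 1 + 2 * e ^+ 2 != 0 by apply: lt0r_neq0; lra.
have d1 : 2 - e ^+ 2 != 0 by apply: lt0r_neq0; lra.
have d2 : 8 + e ^+ 2 != 0 by apply: lt0r_neq0; lra.
have d3 : 16 + 2 * e ^+ 2 != 0 by apply: lt0r_neq0; lra.
(* The point on the segment towards s diag(3,-1) that is rank-one connected to s diag(1,3). *)
have h1 : lamination_hull K
    (mx2 (s * (1 - 2 * e ^+ 2 / (2 - e ^+ 2))) (4 * e / (2 - e ^+ 2))
         (4 * e / (2 - e ^+ 2)) (s * (-1 - 4 * e ^+ 2 / (2 - e ^+ 2)))).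
  apply: (hull_mx2 _ _ ((1 + 2 * e ^+ 2) / (2 - e ^+ 2)) _ _ _ _ _ _ _ _ _ _ _ _ h0 hP).
  - by case: s1 => ->; field; rewrite ?d0 ?d1 ?d2.
  (* The weight is at most 1 exactly when 3 e^2 <= 1, which e <= 1/2 ensures. *)
  - apply/andP; split; [rewrite divr_ge0; lra|rewrite ler_pdivrMr; lra].
  - by field; rewrite ?d0 ?d1 ?d2.
  - by field; rewrite ?d0 ?d1 ?d2.
  - by field; rewrite ?d0 ?d1 ?d2.
  - by field; rewrite ?d0 ?d1 ?d2.
(* This weight lands on the conic for -s, whose points are rank-one connected to the next target -s
   diag(3,-1). *)
apply: (hull_mx2 _ _ (2 * (2 - e ^+ 2) / (8 + e ^+ 2)) _ _ _ _ _ _ _ _ _ _ _ _ h1 hP').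
- by case: s1 => ->; field; rewrite ?d0 ?d1 ?d2 ?d3.
- apply/andP; split; [rewrite divr_ge0; lra|rewrite ler_pdivrMr; lra].
- by field; rewrite ?d0 ?d1 ?d2 ?d3.
- by field; rewrite ?d0 ?d1 ?d2 ?d3.
- by field; rewrite ?d0 ?d1 ?d2 ?d3.
- by field; rewrite ?d0 ?d1 ?d2 ?d3.
Qed.

Lemma sym_spiral_step (R : realType) (Q : 'M[R]_2) (e : R) :
  0 < e <= 2^-1 ->
  lamination_hull (five_points Q) (sym_spiral R 1 e) ->
  lamination_hull (five_points Q) (sym_spiral R 1 (e / 16)).
Proof.
move=> /andP[e0 e2] h0.
have inT X : X \in T4 R -> _ := five_points_T4 R Q X.
have -> : e / 16 = e / 4 / 4 by field.
have h1 : lamination_hull (five_points Q) (sym_spiral R (-1) (e / 4)).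
  apply: sym_spiral_half h0; first by left.
  - by rewrite e0.
  - by apply: inT; rewrite mul1r !inE eqxx !orbT.
  - by apply: inT; rewrite mul1r !inE eqxx !orbT.
have := @sym_spiral_half R (five_points Q) (-1) (e / 4); rewrite opprK !mulN1r.
apply=> //; first by right.
- by apply/andP; split; lra.
- by apply: inT; rewrite !inE eqxx !orbT.
- by apply: inT; rewrite !inE eqxx.
Qed.

Theorem theorem2p2 (R : realType) :
  (exists K : set 'M[R]_2,
     [/\ K `<=` upper_triangular (R:=R), (K #= `I_5)%card
       & ~ compact (lamination_hull K)]) /\
  (exists K : set 'M[R]_2,
     [/\ K `<=` symmetric_matrices (R:=R), (K #= `I_5)%card
       & ~ compact (lamination_hull K)]).
Proof.
split.
  have Q0 : 0 < tri_spiral R 1 0 1 by rewrite mxE.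
  exists (five_points (tri_spiral R 1)); split.
  - move=> X; rewrite /five_points /upper_triangular/= inE.
    move=> /predU1P[->|]; last (move: X; apply: T4P);
      by apply/is_trig_mxP => -[[|[|//]] i2] [[|[|//]] j2] //= _; rewrite !mxE.
  - exact: five_points_card.
  - apply: (hull_not_compact _ _ (@tri_spiral R) 1) => //.
    + by move=> e _; exact: tri_spiral_step.
    + move=> e /andP[e0 _]; rewrite /gap !mxE /= !addNr normr0; lra.
have Q0 : 0 < sym_spiral R 1 2^-1 0 1.
  by rewrite mxE /= divr_gt0 ?mulr_gt0 ?addr_gt0 ?exprn_gt0 ?invr_gt0.
exists (five_points (sym_spiral R 1 2^-1)); split.
- move=> X; rewrite /five_points /symmetric_matrices/= inE.
  by move=> /predU1P[->|]; last (move: X; apply: T4P);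
    apply: mx2_eqP; rewrite !mxE.
- exact: five_points_card.
- apply: (hull_not_compact _ _ (@sym_spiral R 1) 2^-1) => //.
  + by move=> e; exact: sym_spiral_step.
  + move=> e /andP[e0 e2]; rewrite /gap !mxE /=.
    set D := 1 + 2 * e ^+ 2.
    have D1 : 1 <= D by rewrite lerDl mulr_ge0 ?sqr_ge0.
    have D0 : 0 < D by lra.
    have b_le : 4 * e / D <= 4 * e by rewrite ler_pdivrMr//; nra.
    have u_ge : 0 <= 4 * e ^+ 2 / D by rewrite divr_ge0 ?mulr_ge0 ?sqr_ge0 ?ltW.
    (* Here e <= 1/2 turns the quadratic term into a linear one; the gap is 4e/D + 3u <= 10e. *)
    have u_le : 4 * e ^+ 2 / D <= 2 * e by rewrite ler_pdivrMr//; nra.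
    set u := 4 * e ^+ 2 / D in u_ge u_le *.
    rewrite ger0_norm; last lra.
    rewrite ler0_norm; lra.
Qed.
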